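(* For all integers $k\ge 2$ and $c\ge 1$ there exists a tight circular $\mathrm{SCCD}(2c(k-1)+1,\,k,\,c^2(2k-2)+c)$.
   Context: A circular single change covering design $\mathrm{SCCD}(v,k,b)$ is a $v$-set $X$ with a cyclically ordered list $(B_1,\dots,B_b)$ of $k$-subsets of $X$ with $|B_i\cap B_{i+1}|=k-1$ for all $i$ (indices mod $b$) such that every pair of elements of $X$ is contained in some block. It is tight if $\binom{v}{2}/(k-1)$ is an integer and $b=\binom{v}{2}/(k-1)$ (equivalently, each pair is covered exactly once, where a pair is covered in $B_i$ if it lies in $B_i$ and contains the element of $B_i\setminus B_{i-1}$). *)

(* Defs.v *)
(* MathComp *)
From mathcomp Require Import all_boot.
Set Implicit Arguments.
Unset Strict Implicit.
Unset Printing Implicit Defensive.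

(* The cyclic list of blocks is indexed by 'I_b, [ordS] being the successor
   modulo b; blocks may repeat. *)
Definition circular_SCCD (X : finType) (v k b : nat) (B : 'I_b -> {set X}) :
    Prop :=
  [/\ #|X| = v,
      forall i : 'I_b, #|B i| = k,
      forall i : 'I_b, #|B i :&: B (ordS i)| = k - 1
    & forall x y : X, x != y -> exists i : 'I_b, x \in B i /\ y \in B i].

Definition tight_circular_SCCD (X : finType) (v k b : nat)
    (B : 'I_b -> {set X}) : Prop :=
  [/\ circular_SCCD v k B, k - 1 %| 'C(v, 2) & b = 'C(v, 2) %/ (k - 1)].

(* Main.v *)
(* Put m = k - 1 and v = 2cm + 1. For t in Z_v hold the interval
   T_t = {t, ..., t + m - 1} and let the remaining point of the block run
   through t + cm, t + (c - 1)m, ..., t + m. The last block of this run is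
   T_(t+1) with t added, so the run for t + 1 can follow. The point t + jm has
   the differences (j - 1)m + 1, ..., jm with T_t, hence every difference
   1, ..., cm occurs at every translate, which accounts for all pairs of Z_v. *)
Require Import Defs.
From mathcomp Require Import all_boot.
From mathcomp Require Import zify.

Set Implicit Arguments.
Unset Strict Implicit.
Unset Printing Implicit Defensive.

(** Reducing first keeps [inord] away from its default value, so positions can be computed in the
    naturals. *)
Definition residue (N n : nat) : 'I_N.+1 := inord (n %% N.+1).

Lemma eq_residue (N a b : nat) :
  (residue N a == residue N b) = (a == b %[mod N.+1]).
Proof. by rewrite -val_eqE /= !inordK ?ltn_mod. Qed.

Lemma residue_mod (N n : nat) : residue N (n %% N.+1) = residue N n.
Proof. by apply/eqP; rewrite eq_residue modn_mod. Qed.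

Lemma residue_ord (N : nat) (x : 'I_N.+1) : residue N x = x.
Proof. by apply: val_inj; rewrite /= inordK ?ltn_mod // modn_small. Qed.

Lemma eq_residue_addl (N t a b : nat) : a <= N -> b <= N ->
  (residue N (t + a) == residue N (t + b)) = (a == b).
Proof. by move=> leaN lebN; rewrite eq_residue eqn_modDl !modn_small. Qed.

Definition arc (N m t : nat) : {set 'I_N.+1} :=
  [set residue N (t + u) | u : 'I_m].

Lemma arcP (N m t : nat) (x : 'I_N.+1) :
  reflect (exists2 u, u < m & x = residue N (t + u)) (x \in arc N m t).
Proof.
apply: (iffP imsetP) => [[u _ ->]|[u ltum ->]]; first by exists u.
by exists (Ordinal ltum).
Qed.

Lemma card_arc (N m t : nat) : m <= N.+1 -> #|arc N m t| = m.
Proof.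
move=> lemN; rewrite card_imset ?card_ord // => u w /eqP.
have le_ord (z : 'I_m) : z <= N by rewrite -ltnS (leq_trans (ltn_ord z)).
by rewrite eq_residue_addl ?le_ord // => /eqP/val_inj.
Qed.

Lemma arc_notin (N m t a : nat) : m <= a <= N -> residue N (t + a) \notin arc N m t.
Proof.
case/andP=> lema leaN; apply/arcP => -[u ltum /eqP].
by rewrite eq_residue_addl //; lia.
Qed.

Lemma arc_mod (N m t : nat) : arc N m (t %% N.+1) = arc N m t.
Proof.
by apply: eq_imset => u; apply/eqP; rewrite eq_residue modnDml.
Qed.

(** Both sides are the residues of [t], ..., [t + m]; this is where one run hands over to the
    next. *)
Lemma arc_shift (N m t : nat) :
  residue N (t + m) |: arc N m t = residue N t |: arc N m t.+1.
Proof.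
apply/setP => x; rewrite !in_setU1; apply/orP/orP.
- case=> [/eqP->|/arcP[[|u] ltum ->]].
  + case: m => [|m]; first by rewrite addn0 eqxx; left.
    by right; apply/arcP; exists m => //; rewrite addSnnS.
  + by left; rewrite addn0.
  + by right; apply/arcP; exists u; [lia | rewrite addSnnS].
- case=> [/eqP->|/arcP[u ltum ->]].
  + case: m => [|m]; first by rewrite addn0 eqxx; left.
    by right; apply/arcP; exists 0; rewrite ?addn0.
  + case: (ltnP u.+1 m) => [ltSum|lemSu].
      by right; apply/arcP; exists u.+1; rewrite ?addSnnS.
    by left; rewrite addSnnS; have -> : u.+1 = m by lia.
Qed.

Lemma setU1I (T : finType) (a b : T) (A : {set T}) :
  a != b -> (a |: A) :&: (b |: A) = A.
Proof.
move=> neq_ab; rewrite -setUIl (_ : [set a] :&: [set b] = set0) ?set0U //.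
by apply/setP => x; rewrite !inE; case: eqP => // ->; apply: negbTE.
Qed.

(** Index [n = t * c + j] stands for step [j] of run [t]. *)
Definition apex (N c m n : nat) : 'I_N.+1 :=
  residue N (n %/ c + (c - n %% c) * m).

Definition arc_block (N c m n : nat) : {set 'I_N.+1} :=
  apex N c m n |: arc N m (n %/ c).

(** Adding [N.+1 * c] to [n] keeps the step and moves the run by [N.+1], so the list closes up
    cyclically. *)
Lemma arc_block_mod (N c m n : nat) :
  arc_block N c m (n %% (N.+1 * c)) = arc_block N c m n.
Proof.
rewrite /arc_block /apex -modn_divl (modn_dvdm _ (dvdn_mull _ (dvdnn c))).
by rewrite arc_mod; congr (_ |: _); apply/eqP; rewrite eq_residue modnDml.
Qed.

Section Blocks.

Variables (c m : nat).
Hypotheses (c_gt0 : 0 < c) (m_gt0 : 0 < m).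
Let N := 2 * c * m.

Lemma card_arc_block (n : nat) : #|arc_block N c m n| = m.+1.
Proof.
have ltc := ltn_pmod n c_gt0.
by rewrite cardsU1 arc_notin ?card_arc /N //; nia.
Qed.

Lemma card_arc_blockI (n : nat) :
  #|arc_block N c m n :&: arc_block N c m n.+1| = m.
Proof.
have ltc := ltn_pmod n c_gt0; have lemN : m <= N.+1 by rewrite /N; nia.
rewrite /arc_block /apex.
rewrite (divn_eq n c); move: (n %/ c) (n %% c) ltc => t j ltjc.
rewrite -addnS !divnMDl // !modnMDl divn_small // modn_small // addn0.
case: (ltnP j.+1 c) => [ltSjc|leSjc].
  (* Inside a run the arc stays and the apex offset drops by [m]. *)
  rewrite divn_small // modn_small // addn0 setU1I ?card_arc //.
  by rewrite eq_residue_addl /N; nia.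
have -> : j.+1 = c by lia.
(* At the end of a run the offset is [m]. After the shift, [t] is replaced by [t + 1 + c * m], a
   different residue since [c * m + 1 <= N]. *)
rewrite divnn c_gt0 modnn subn0 addn1 (_ : c - j = 1) ?mul1n; last by lia.
rewrite arc_shift setU1I ?card_arc //.
by rewrite -{1}[t]addn0 addSnnS eq_residue_addl // /N; nia.
Qed.

Lemma arc_block_cover (a d : nat) : 0 < d <= c * m ->
  exists n, residue N a \in arc_block N c m n /\
            residue N (a + d) \in arc_block N c m n.
Proof.
case/andP=> d_gt0 led.
have ltr := ltn_pmod d.-1 m_gt0; have Ed := divn_eq d.-1 m.
(* Dividing [d.-1] gives [d = j * m + r.+1] with [0 < r.+1 <= m], so [d] leads from offset
   [m - r.+1] in the arc to the apex offset [j.+1 * m]. *)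
move: (d.-1 %/ m) (d.-1 %% m) ltr Ed => j r ltrm Ed.
have ltjc : j < c by nia.
(* Adding [N.+1] keeps the subtraction from truncating. *)
pose t := a + N.+1 - (m - r.+1).
have Et : t + (m - r.+1) = a + N.+1 by rewrite /t /N; nia.
(* Step [c - j.+1] of run [t] has apex offset [j.+1 * m]. *)
exists (t * c + (c - j.+1)); rewrite /arc_block /apex divnMDl // modnMDl.
rewrite divn_small ?modn_small ?addn0; try lia.
rewrite subKn //; split; rewrite in_setU1; apply/orP.
  right; apply/arcP; exists (m - r.+1); first by lia.
  by apply/eqP; rewrite Et eq_residue modnDr.
left; rewrite eq_residue (_ : t + j.+1 * m = a + d + N.+1) ?modnDr //.
by move: Et; nia.
Qed.

(** The two cyclic distances between [x] and [y] sum to [2 * c * m + 1], so one of them is at most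
    [c * m]. *)
Lemma arc_block_pair (x y : 'I_N.+1) : x != y ->
  exists n, x \in arc_block N c m n /\ y \in arc_block N c m n.
Proof.
wlog ltxy : x y / x < y => [IH neq_xy|_].
  case: (ltngtP x y) (neq_xy) => [lt|lt|/val_inj->]; last by rewrite eqxx.
    by move=> _; apply: IH.
  by move=> _; case: (IH y x lt); rewrite 1?eq_sym // => n []; exists n.
have ltyN := ltn_ord y.
have [led|ltd] := leqP (y - x) (c * m).
  have [|n] := @arc_block_cover x (y - x); first by lia.
  by rewrite subnKC ?residue_ord 1?ltnW //; exists n.
have [|n] := @arc_block_cover y (x + N.+1 - y).
  by move: ltd ltyN; rewrite /N; nia.
rewrite subnKC; last by lia.
by rewrite -(residue_mod _ (x + _)) modnDr residue_mod !residue_ord => -[]; exists n.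
Qed.

End Blocks.

Theorem theorem7 (k c : nat) (hk : 2 <= k) (hc : 1 <= c) :
  exists (X : finType) (B : 'I_(c ^ 2 * (2 * k - 2) + c) -> {set X}),
    tight_circular_SCCD (2 * c * (k - 1) + 1) k B.
Proof.
case: k hk => [//|m] m_gt0; rewrite subn1 /=.
set N := 2 * c * m.
(* There are [N.+1] runs of [c] blocks each. *)
have Eb : c ^ 2 * (2 * m.+1 - 2) + c = N.+1 * c by rewrite /N; nia.
rewrite Eb.
have Ebin : 'C(N + 1, 2) = N.+1 * c * m.
  rewrite addn1 bin2 /= (_ : N.+1 * N = (N.+1 * c * m).*2) ?doubleK //.
  by rewrite /N -muln2; nia.
exists 'I_N.+1, (fun i : 'I_(N.+1 * c) => arc_block N c m i).
rewrite /tight_circular_SCCD subn1 /= Ebin dvdn_mull // mulnK //.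
split=> //; split.
- by rewrite card_ord addn1.
- by move=> i; apply: card_arc_block.
- by move=> i; rewrite arc_block_mod subn1; apply: card_arc_blockI.
move=> x y /(arc_block_pair hc m_gt0)[n].
rewrite -/N -arc_block_mod => n_cov.
have ltb : n %% (N.+1 * c) < N.+1 * c by rewrite ltn_mod muln_gt0.
by exists (Ordinal ltb).
Qed.
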